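(* Let $n\ge1$ be an integer, let $z\in\mathbb{C}$ with $|z|<1$, and put $s=\sqrt{\frac{z}{z-1}}$. Then $${}_2F_1\bigl(1-\tfrac n2,1-\tfrac n2;\tfrac32-n;z\bigr)=\frac{(1-z)^{n/2-1}}{4\binom{2n-2}{n-1}}\sum_{k=1}^{n}2^k\binom{2n-k-1}{n-1}\binom{n-1}{k-1}\Bigl[(1-s)^{n-k}+(-1)^{k-1}(1+s)^{n-k}\Bigr]s^{k-1}$$ and $${}_2F_1\bigl(\tfrac12-\tfrac n2,\tfrac12-\tfrac n2;\tfrac12-n;z\bigr)=\frac{n!\,(1-z)^{(n-1)/2}}{2\binom{2n}{n}}\sum_{k=0}^{n}\frac{2^k}{k!}\binom{2n-2k}{n-k}\sum_{j=0}^{k}\frac{(2k-2j-1)!!}{(n-j)!}\binom{2k-j-1}{j-1}\Bigl[(1-s)^{n-j}+(-1)^j(1+s)^{n-j}\Bigr]s^{j}.$$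
   Context: The Gauss hypergeometric function is ${}_2F_1(a,b;c;z)=\sum_{m=0}^{\infty}\frac{(a)_m(b)_m}{(c)_m}\frac{z^m}{m!}$ for $|z|<1$, where $(a)_0=1$ and $(a)_m=a(a+1)\dotsm(a+m-1)$ for $m\ge1$. $m!!$ is the double factorial of an odd integer $m\ge1$, the product $m(m-2)\dotsm1$, with $(-1)!!=1$. Binomial conventions: $\binom{-1}{-1}=1$ and $\binom{m}{-1}=0$ for integers $m\ge0$. The square root and non-integer powers are principal branches, and $s^0=1$, including when $s=0$. *)

(* Defs.v *)
From Stdlib Require Import Reals Lra Lia ZArith.
From Coquelicot Require Import Coquelicot.

Open Scope C_scope.

Definition Cexp (z : C) : C :=
  ((exp (Re z) * cos (Im z))%R, (exp (Re z) * sin (Im z))%R).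

(* Principal argument, in (-PI, PI]; meaningful for z <> 0 only. *)
Definition Carg (z : C) : R :=
  if Rle_dec 0 (Im z) then acos (Re z / Cmod z) else (- acos (Re z / Cmod z))%R.

Definition Clog (z : C) : C := (ln (Cmod z), Carg z).

(* Principal branch of z^a, extended to the base 0 by 0^0 = 1 and 0^a = 0
   for a <> 0. *)
Definition Cpower (z a : C) : C :=
  if Ceq_dec z 0 then (if Ceq_dec a 0 then RtoC 1 else RtoC 0)
  else Cexp (a * Clog z).

Definition Csqrt (z : C) : C := Cpower z (1 / 2).

Fixpoint Cpoch (a : C) (m : nat) : C :=
  match m with
  | O => RtoC 1
  | S p => Cpoch a p * (a + INR p)
  end.

(* The Gauss series at z converges and its sum is v. *)
Definition is_hyp2F1 (a b c z v : C) : Prop :=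
  @is_series C_AbsRing C_NormedModule
    (fun m : nat => Cpoch a m * Cpoch b m / Cpoch c m * (z ^ m / INR (fact m)))
    v.

(* odd_dfact p is (2p-1)!!, so odd_dfact 0 is (-1)!! = 1. *)
Fixpoint odd_dfact (p : nat) : nat :=
  match p with
  | O => 1
  | S q => (2 * q + 1) * odd_dfact q
  end.

(* The library's Binomial.C is meant for natural arguments k <= m; here
   (-1 choose -1) = 1 and (m choose -1) = 0 for m >= 0. *)
Definition binomZ (m k : Z) : R :=
  if ((m =? -1) && (k =? -1))%Z%bool then 1%R
  else if ((0 <=? k) && (k <=? m))%Z%bool
       then Binomial.C (Z.to_nat m) (Z.to_nat k)
       else 0%R.

Lemma Cmod_sqr (z : C) : (Re z * Re z + Im z * Im z = Cmod z * Cmod z)%R.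
Proof.
unfold Cmod. rewrite sqrt_sqrt.
- unfold Re, Im; ring.
- assert (H1 := pow2_ge_0 (fst z)). assert (H2 := pow2_ge_0 (snd z)). lra.
Qed.

Lemma Re_div_Cmod_bounds (z : C) : z <> 0 -> (-1 <= Re z / Cmod z <= 1)%R.
Proof.
intros Hz. apply Cmod_gt_0 in Hz. assert (H := Cmod_sqr z).
assert (H1 := Rle_0_sqr (Im z)); unfold Rsqr in H1.
split; [apply Rle_div_r | apply Rle_div_l]; try exact Hz; nra.
Qed.

Lemma Carg_bounds (z : C) : z <> 0 -> (- PI < Carg z <= PI)%R.
Proof.
intros Hz. assert (Hm := proj1 (Cmod_gt_0 z) Hz). assert (HPI := PI_RGT_0).
assert (H := Cmod_sqr z). assert (Hb := Re_div_Cmod_bounds z Hz).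
assert (Ha := acos_bound (Re z / Cmod z)).
unfold Carg; destruct (Rle_dec 0 (Im z)) as [Hi|Hi]; [lra|].
split; [|lra].
destruct (Req_dec (acos (Re z / Cmod z)) PI) as [Ep|Ep]; [exfalso|lra].
assert (Ec := cos_acos _ Hb). rewrite Ep, cos_PI in Ec.
assert (E : (Re z = (Re z / Cmod z) * Cmod z)%R) by (field; lra).
rewrite <- Ec in E. nra.
Qed.

Lemma Cexp_Clog (z : C) : z <> 0 -> Cexp (Clog z) = z.
Proof.
intros Hz. assert (Hm := proj1 (Cmod_gt_0 z) Hz).
assert (H := Cmod_sqr z). assert (Hb := Re_div_Cmod_bounds z Hz).
assert (Hs : (Cmod z * sin (acos (Re z / Cmod z)) = Rabs (Im z))%R).
{ rewrite sin_acos by exact Hb.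
  rewrite <- (sqrt_Rsqr (Cmod z)) at 1 by lra.
  rewrite <- sqrt_mult_alt by apply Rle_0_sqr.
  rewrite <- sqrt_Rsqr_abs. f_equal. unfold Rsqr.
  assert (E : (Im z * Im z = Cmod z * Cmod z - Re z * Re z)%R) by lra.
  rewrite E. field. lra. }
unfold Cexp, Clog; simpl Re; simpl Im. rewrite exp_ln by exact Hm.
rewrite (surjective_pairing z) at 5.
assert (Hc : (Cmod z * cos (acos (Re z / Cmod z)) = Re z)%R).
{ rewrite cos_acos by exact Hb. field. lra. }
unfold Carg; destruct (Rle_dec 0 (Im z)) as [Hi|Hi].
- rewrite Hc, Hs, Rabs_pos_eq by exact Hi. reflexivity.
- rewrite cos_neg, sin_neg, Hc, Ropp_mult_distr_r_reverse, Hs.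
  rewrite Rabs_left by lra. rewrite Ropp_involutive. reflexivity.
Qed.

(* Main.v *)
Require Import Defs.
From Stdlib Require Import Reals ZArith Lra Lia.
From Coquelicot Require Import Coquelicot.

Open Scope C_scope.

(* Both left-hand sides are F(a, a; c; z) with a = (1 - N)/2, c = 1/2 - N, where
   N = n - 1 in the first formula and N = n in the second. The Pfaff
   transformation gives (1 - z)^(-a) F(a, c - a; c; s^2), and the last series
   terminates: up to the factor binom(2N, N) it is the reversed Legendre
   polynomial 2^N s^N P_N(1/s), the coefficient of h^N in ((1 + h)^2 - s^2)^N.
   Expanding the same coefficient in powers of 1 - s + h gives an expression in
   1 - s and s; as the polynomial is even, averaging over s and -s yields the
   first formula. The second reduces to the same expression after exchanging the
   two sums, because the inner sum is a convolution of powers of the Catalan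
   series with the series of the central binomial coefficients.
   The binomial series for half-integer exponents, needed for the Pfaff
   transformation, is obtained from the exponents 1, -1 and 1/2 by Cauchy
   products. *)

(** * Sums and binomial coefficients *)

(* Sums over C_AbelianMonoid are typed in the carrier of that structure, which
   ring and field do not recognise as C. *)
Ltac Cring := match goal with |- @eq _ ?x ?y => change (@eq C x y) end; ring.
Ltac Cfield := match goal with |- @eq _ ?x ?y => change (@eq C x y) end; field.

Lemma INR_C_S (n : nat) : RtoC (INR (S n)) = INR n + 1.
Proof. rewrite S_INR, RtoC_plus; reflexivity. Qed.

Lemma Csum_S (f : nat -> C) (n : nat) : sum_n f (S n) = sum_n f n + f (S n).
Proof. exact (sum_Sn f n). Qed.

Lemma Csum_ext (f g : nat -> C) (n : nat) :
  (forall k, (k <= n)%nat -> f k = g k) -> sum_n f n = sum_n g n.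
Proof. exact (sum_n_ext_loc f g n). Qed.

Lemma Csum_plus (f g : nat -> C) (n : nat) :
  sum_n (fun k => f k + g k) n = sum_n f n + sum_n g n.
Proof. exact (sum_n_plus f g n). Qed.

Lemma Csum_mult_l (a : C) (f : nat -> C) (n : nat) :
  sum_n (fun k => a * f k) n = a * sum_n f n.
Proof. exact (sum_n_mult_l a f n). Qed.

Lemma Csum_Sl (f : nat -> C) (n : nat) :
  sum_n f (S n) = f O + sum_n (fun k => f (S k)) n.
Proof.
induction n as [|n IH].
- now rewrite Csum_S, !sum_O.
- rewrite Csum_S, IH, Csum_S; Cring.
Qed.

(** Substitute [k = j + p]. In the induction, row [S n] adds one term to each column [j <= n] and
    opens the column [j = S n]. *)
Lemma Csum_triangle (F : nat -> nat -> C) (n : nat) :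
  sum_n (fun k => sum_n (F k) k) n =
  sum_n (fun j => sum_n (fun p => F (j + p)%nat j) (n - j)) n.
Proof.
induction n as [|n IH].
- now rewrite !sum_O.
- rewrite Csum_S, IH, (Csum_S _ n), Csum_S, Nat.sub_diag, sum_O, Nat.add_0_r.
  rewrite Cplus_assoc; f_equal.
  rewrite <- Csum_plus; apply Csum_ext; intros j Hj.
  replace (S n - j)%nat with (S (n - j)) by lia.
  rewrite Csum_S; do 2 f_equal; lia.
Qed.

(** The recursion gives 0 for [k > n], so shifted sums need no range conditions. *)
Fixpoint binom (n k : nat) : nat :=
  match n, k with
  | _, O => 1
  | O, S _ => 0
  | S m, S j => binom m j + binom m (S j)
  end.

Lemma binom_n_0 (n : nat) : binom n 0 = 1%nat.
Proof. now destruct n. Qed.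

Lemma binom_S_S (n k : nat) :
  binom (S n) (S k) = (binom n k + binom n (S k))%nat.
Proof. reflexivity. Qed.

Lemma binom_gt (n k : nat) : (n < k)%nat -> binom n k = 0%nat.
Proof.
revert k; induction n as [|n IH]; intros [|k] H; try lia; simpl; auto.
rewrite !IH; lia.
Qed.

Lemma binom_diag (n : nat) : binom n n = 1%nat.
Proof. induction n as [|n IH]; simpl; auto; rewrite IH, binom_gt; lia. Qed.

Lemma binom_fact (i j : nat) :
  (binom (i + j) i * (fact i * fact j) = fact (i + j))%nat.
Proof.
revert j; induction i as [|i IHi]; intros j.
- rewrite binom_n_0; simpl; lia.
- induction j as [|j IHj].
  + rewrite Nat.add_0_r, binom_diag; simpl; lia.
  + specialize (IHi (S j)).
    replace (S i + S j)%nat with (S (i + S j)) by lia.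
    rewrite binom_S_S, Nat.mul_add_distr_r.
    replace (i + S j)%nat with (S i + j)%nat in * by lia.
    rewrite (fact_simpl (S i + j)).
    replace (binom (S i + j) i * (fact (S i) * fact (S j)))%nat
      with (S i * (binom (S i + j) i * (fact i * fact (S j))))%nat
      by (rewrite (fact_simpl i); ring).
    rewrite IHi.
    replace (binom (S i + j) (S i) * (fact (S i) * fact (S j)))%nat
      with (S j * (binom (S i + j) (S i) * (fact (S i) * fact j)))%nat
      by (rewrite (fact_simpl j); ring).
    rewrite IHj; ring.
Qed.

Lemma INR_binom (n k : nat) : (k <= n)%nat ->
  INR (binom n k) = (INR (fact n) / (INR (fact k) * INR (fact (n - k))))%R.
Proof.
intros H; pose proof (binom_fact k (n - k)) as E.
replace (k + (n - k))%nat with n in E by lia.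
rewrite <- E, !mult_INR; field; split; apply INR_fact_neq_0.
Qed.

Lemma Binomial_C_binom (n k : nat) : (k <= n)%nat ->
  Binomial.C n k = INR (binom n k).
Proof. intros H; now rewrite INR_binom. Qed.

Lemma binom_pos (n k : nat) : (k <= n)%nat -> (0 < binom n k)%nat.
Proof.
intros H; pose proof (binom_fact k (n - k)) as E.
replace (k + (n - k))%nat with n in E by lia.
pose proof (lt_O_fact n); destruct (binom n k); lia.
Qed.

Lemma central_binom_neq_0 (n : nat) : RtoC (INR (binom (2 * n) n)) <> 0.
Proof.
intros E; apply RtoC_inj in E; revert E; apply not_0_INR.
pose proof (binom_pos (2 * n) n); lia.
Qed.

Lemma binom_absorb_top (n k : nat) :
  (INR (binom (S n) k) * (INR n + 1 - INR k) = (INR n + 1) * INR (binom n k))%R.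
Proof.
destruct (le_lt_dec k n) as [H|H].
- rewrite !INR_binom by lia.
  replace (S n - k)%nat with (S (n - k)) by lia.
  rewrite !fact_simpl, !mult_INR, !S_INR, minus_INR by lia.
  field; repeat split; try apply INR_fact_neq_0.
  rewrite <- minus_INR by lia; rewrite <- S_INR; apply not_0_INR; lia.
- rewrite (binom_gt n k) by lia.
  destruct (Nat.eq_dec k (S n)) as [->|H'].
  + rewrite S_INR; simpl; ring.
  + rewrite binom_gt by lia; simpl; ring.
Qed.

Lemma binom_absorb_bot (n k : nat) :
  (INR (binom n (S k)) * (INR k + 1) = (INR n - INR k) * INR (binom n k))%R.
Proof.
destruct (le_lt_dec (S k) n) as [H|H].
- rewrite !INR_binom by lia.
  replace (n - k)%nat with (S (n - S k)) by lia.
  rewrite !fact_simpl, !mult_INR, !S_INR, minus_INR, S_INR by lia.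
  field; repeat split; try apply INR_fact_neq_0.
  + replace (INR n - (INR k + 1) + 1)%R with (INR n - INR k)%R by ring.
    rewrite <- minus_INR by lia; apply not_0_INR; lia.
  + rewrite <- S_INR; apply not_0_INR; lia.
- rewrite (binom_gt n (S k)) by lia.
  destruct (Nat.eq_dec k n) as [->|H'].
  + simpl; ring.
  + rewrite binom_gt by lia; simpl; ring.
Qed.

(** Pascal's rule under the sum. It drives the inductions for both Vandermonde identities and for
    the powers of a two-term operator. *)
Lemma Csum_binom_S (V : nat -> C) (n : nat) :
  sum_n (fun i => INR (binom (S n) i) * V i) (S n) =
  sum_n (fun i => INR (binom n i) * (V i + V (S i))) n.
Proof.
rewrite Csum_Sl.
transitivity (INR (binom n 0) * V O +
  (sum_n (fun k => INR (binom n k) * V (S k)) n +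
   sum_n (fun k => INR (binom n (S k)) * V (S k)) n)).
{ rewrite <- Csum_plus; f_equal; [now rewrite !binom_n_0|].
  apply Csum_ext; intros k _; rewrite binom_S_S, plus_INR, RtoC_plus; Cring. }
transitivity (sum_n (fun k => INR (binom n k) * V (S k)) n +
  sum_n (fun k => INR (binom n k) * V k) (S n)).
{ rewrite (Csum_Sl (fun k => INR (binom n k) * V k)); Cring. }
rewrite Csum_S, (binom_gt n (S n)) by lia.
simpl INR; rewrite Cmult_0_l, Cplus_0_r, <- Csum_plus.
apply Csum_ext; intros k _; Cring.
Qed.

(** * Pochhammer symbols *)

Lemma Cpoch_Sl (a : C) (m : nat) : Cpoch a (S m) = a * Cpoch (a + 1) m.
Proof.
induction m as [|m IH].
- simpl; ring.
- change (Cpoch a (S (S m))) with (Cpoch a (S m) * (a + INR (S m))).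
  rewrite IH, INR_C_S; simpl; ring.
Qed.

Lemma Cpoch_plus (a : C) (m r : nat) :
  Cpoch a (m + r) = Cpoch a m * Cpoch (a + INR m) r.
Proof.
induction r as [|r IH].
- rewrite Nat.add_0_r; simpl; ring.
- rewrite Nat.add_succ_r; simpl; rewrite IH, plus_INR, RtoC_plus; ring.
Qed.

Lemma Cpoch_neq_0 (c : C) (m : nat) :
  (forall k, c + INR k <> 0) -> Cpoch c m <> 0.
Proof.
intros H; induction m as [|m IH]; simpl; [apply C1_nz|].
now apply Cmult_neq_0.
Qed.

(** After Pascal's rule the two new factors are [a + k] and [b + (m - k)], with sum [a + b + m]. *)
Lemma Cpoch_vandermonde (a b : C) (m : nat) :
  sum_n (fun k => INR (binom m k) * (Cpoch a k * Cpoch b (m - k))) m =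
  Cpoch (a + b) m.
Proof.
induction m as [|m IH].
- rewrite sum_O; simpl; Cring.
- rewrite (Csum_binom_S (fun k => Cpoch a k * Cpoch b (S m - k))).
  simpl Cpoch at 5; rewrite <- IH, Cmult_comm, <- Csum_mult_l.
  apply Csum_ext; intros k Hk.
  replace (S m - k)%nat with (S (m - k)) by lia.
  change (S m - S k)%nat with (m - k)%nat.
  simpl; rewrite minus_INR, RtoC_minus by lia; Cring.
Qed.

(** The sum is F(-r, d; c; 1). Pairing neighbours by Pascal's rule turns it into [(c - d) / c] times
    the sum for [c + 1] and [r - 1], so the induction lets [c] vary. *)
Lemma chu_vandermonde (c d : C) (r : nat) :
  (forall k, c + INR k <> 0) ->
  sum_n (fun m => INR (binom r m) * ((- (1)) ^ m * Cpoch d m / Cpoch c m)) r =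
  Cpoch (c - d) r / Cpoch c r.
Proof.
revert c; induction r as [|r IH]; intros c Hc.
- rewrite sum_O; simpl; Cfield; apply C1_nz.
- rewrite (Csum_binom_S (fun m => (- (1)) ^ m * Cpoch d m / Cpoch c m)).
  assert (Hc0 : c <> 0).
  { specialize (Hc O); simpl in Hc; now rewrite Cplus_0_r in Hc. }
  assert (Hc1 : forall k, c + 1 + INR k <> 0).
  { intros k; specialize (Hc (S k)); rewrite INR_C_S in Hc.
    now replace (c + 1 + INR k) with (c + (INR k + 1)) by Cring. }
  rewrite !Cpoch_Sl.
  replace (Cpoch (c - d + 1) r) with (Cpoch (c + 1 - d) r) by (f_equal; Cring).
  transitivity ((c - d) / c * (Cpoch (c + 1 - d) r / Cpoch (c + 1) r)).
  2: { Cfield; split; [now apply Cpoch_neq_0 | exact Hc0]. }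
  rewrite <- IH by exact Hc1.
  rewrite <- Csum_mult_l; apply Csum_ext; intros m _.
  assert (Hm : Cpoch c m <> 0) by now apply Cpoch_neq_0.
  assert (Hm' : Cpoch (c + 1) m <> 0) by now apply Cpoch_neq_0.
  assert (E : Cpoch c m * (c + INR m) = c * Cpoch (c + 1) m)
    by exact (Cpoch_Sl c m).
  simpl Cpoch; rewrite E.
  replace (Cpoch (c + 1) m) with (Cpoch c m * (c + INR m) / c)
    by (rewrite E; Cfield; exact Hc0).
  rewrite Cpow_S; specialize (Hc m); Cfield; repeat split; assumption.
Qed.

(** * Legendre polynomials *)

(* A polynomial in h is given by its coefficient sequence; this is
   multiplication by c + h. *)
Definition mul_linear (c : C) (f : nat -> C) (k : nat) : C :=
  c * f k + match k with O => 0 | S j => f j end.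

Fixpoint pow_linear (c : C) (m : nat) : nat -> C :=
  match m with
  | O => fun k => match k with O => 1 | S _ => 0 end
  | S p => mul_linear c (pow_linear c p)
  end.

Lemma pow_linear_coef (c : C) (m k : nat) :
  pow_linear c m k = INR (binom m k) * c ^ (m - k).
Proof.
revert k; induction m as [|m IH]; intros [|k]; simpl pow_linear;
  unfold mul_linear.
- simpl; ring.
- simpl; ring.
- rewrite IH, !binom_n_0, !Nat.sub_0_r, Cpow_S; simpl; ring.
- rewrite !IH, binom_S_S, plus_INR, RtoC_plus.
  change (S m - S k)%nat with (m - k)%nat.
  destruct (le_lt_dec (S k) m) as [H|H].
  + replace (m - k)%nat with (S (m - S k)) by lia; rewrite Cpow_S; ring.
  + rewrite (binom_gt m (S k)) by lia; simpl INR; ring.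
Qed.

Lemma mul_linear_ext (c : C) (f g : nat -> C) (k : nat) :
  (forall j, f j = g j) -> mul_linear c f k = mul_linear c g k.
Proof. intros H; unfold mul_linear; destruct k; now rewrite !H. Qed.

Lemma mul_linear_sum (c : C) (a : nat -> C) (f : nat -> nat -> C) (n k : nat) :
  mul_linear c (fun j => sum_n (fun i => a i * f i j) n) k =
  sum_n (fun i => a i * mul_linear c (f i) k) n.
Proof.
unfold mul_linear; destruct k as [|k].
- rewrite <- Csum_mult_l, Cplus_0_r; apply Csum_ext; intros i _; Cring.
- rewrite <- Csum_mult_l, <- Csum_plus; apply Csum_ext; intros i _; Cring.
Qed.

(* Multiplication by (1 + h)^2 - s^2. *)
Definition mul_legendre (s : C) (f : nat -> C) : nat -> C :=
  mul_linear (1 - s) (mul_linear (1 + s) f).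

Lemma mul_legendre_ext (s : C) (f g : nat -> C) (k : nat) :
  (forall j, f j = g j) -> mul_legendre s f k = mul_legendre s g k.
Proof.
intros H; apply mul_linear_ext; intros j; now apply mul_linear_ext.
Qed.

Lemma mul_legendre_sum (s : C) (a : nat -> C) (f : nat -> nat -> C) (n k : nat) :
  mul_legendre s (fun j => sum_n (fun i => a i * f i j) n) k =
  sum_n (fun i => a i * mul_legendre s (f i) k) n.
Proof.
unfold mul_legendre.
rewrite <- (mul_linear_sum _ a (fun i => mul_linear (1 + s) (f i))).
apply mul_linear_ext; intros j; apply mul_linear_sum.
Qed.

(** A binomial theorem: each multiplication is a step in [p] plus [c] times a step in [q], and these
    steps commute because [V] records only their numbers. *)
Lemma iter_mul_legendre (s c : C) (V : nat -> nat -> nat -> C) (n k : nat) :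
  (forall p q j, mul_legendre s (V p q) j = V (S p) q j + c * V p (S q) j) ->
  Nat.iter n (mul_legendre s) (V O O) k =
  sum_n (fun i => INR (binom n i) * (c ^ i * V (n - i)%nat i k)) n.
Proof.
intros HV; revert k; induction n as [|n IH]; intros k.
- rewrite sum_O; simpl; ring.
- simpl Nat.iter; rewrite (mul_legendre_ext _ _ _ _ IH).
  transitivity (mul_legendre s (fun j =>
    sum_n (fun i => (INR (binom n i) * c ^ i) * V (n - i)%nat i j) n) k).
  { apply mul_legendre_ext; intros j; apply Csum_ext; intros i _; Cring. }
  rewrite mul_legendre_sum.
  rewrite (Csum_binom_S (fun i => c ^ i * V (S n - i)%nat i k)).
  apply Csum_ext; intros i Hi; rewrite HV.
  change (S n - S i)%nat with (n - i)%nat.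
  replace (S n - i)%nat with (S (n - i)) by lia.
  rewrite Cpow_S; Cring.
Qed.

(* With s = 1/x this is 2^n s^n P_n(x), P_n the Legendre polynomial. *)
Definition legendre (n : nat) (s : C) : C :=
  sum_n (fun m => INR (binom n m) * ((- (1)) ^ m * INR (binom (2 * (n - m)) n)) *
                  (s * s) ^ m) n.

(* Both sides are the coefficient of h^n in ((1 + h)^2 - s^2)^n: expand in
   powers of s^2, or put u = 1 - s + h and expand (u^2 + 2 s u)^n. *)
Lemma legendre_murphy (n : nat) (s : C) :
  legendre n s =
  sum_n (fun i => INR (binom n i) * INR (binom (2 * n - i) n) * 2 ^ i *
                  (1 - s) ^ (n - i) * s ^ i) n.
Proof.
transitivity (Nat.iter n (mul_legendre s) (pow_linear 1 0) n).
- rewrite (iter_mul_legendre s (- (s * s)) (fun p q => pow_linear 1 (2 * p))).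
  + apply Csum_ext; intros m _; rewrite pow_linear_coef, Cpow_1_l.
    replace (- (s * s)) with (- (1) * (s * s)) by ring.
    rewrite (Cpow_mult_l (- (1))); Cring.
  + intros p _ j; replace (2 * S p)%nat with (S (S (2 * p))) by lia.
    unfold mul_legendre; simpl pow_linear; unfold mul_linear.
    destruct j as [|[|j]]; ring.
(* The zeroth power is the same for every base, so it may be read as u^0. Now [V p q] is u^(2p + q),
   and (1 + h)^2 - s^2 = u^2 + 2 s u. *)
- change (pow_linear 1 0) with (pow_linear (1 - s) (2 * 0 + 0)).
  rewrite (iter_mul_legendre s (2 * s)
             (fun p q => pow_linear (1 - s) (2 * p + q))).
  + apply Csum_ext; intros i Hi; rewrite pow_linear_coef, Cpow_mult_l.
    replace (2 * (n - i) + i)%nat with (2 * n - i)%nat by lia.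
    replace (2 * n - i - n)%nat with (n - i)%nat by lia; ring.
  + intros p q j.
    replace (2 * S p + q)%nat with (S (S (2 * p + q))) by lia.
    replace (2 * p + S q)%nat with (S (2 * p + q)) by lia.
    unfold mul_legendre; simpl pow_linear; unfold mul_linear.
    destruct j as [|[|j]]; ring.
Qed.

Lemma legendre_opp (n : nat) (s : C) : legendre n (- s) = legendre n s.
Proof.
apply Csum_ext; intros m _; now replace (- s * - s) with (s * s) by ring.
Qed.

Lemma Cpow_opp (s : C) (n : nat) : (- s) ^ n = (- (1)) ^ n * s ^ n.
Proof. rewrite <- Cpow_mult_l; f_equal; ring. Qed.

Lemma legendre_symmetric (n : nat) (s : C) :
  2 * legendre n s =
  sum_n (fun i => INR (binom n i) * INR (binom (2 * n - i) n) * 2 ^ i *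
    ((1 - s) ^ (n - i) + (- (1)) ^ i * (1 + s) ^ (n - i)) * s ^ i) n.
Proof.
transitivity (legendre n s + legendre n (- s)).
{ rewrite legendre_opp; ring. }
rewrite !legendre_murphy, <- Csum_plus.
apply Csum_ext; intros i _; rewrite Cpow_opp.
replace (1 - - s) with (1 + s) by ring; ring.
Qed.

(** * Ballot numbers *)

(* These are the coefficients of the j-th power of the Catalan series: the
   value is j / (2p + j) * binom(2p + j, p), with value 1 at j = p = 0. *)
Definition ballot (j p : nat) : R :=
  match p with
  | O => 1
  | S q => (INR j * INR (fact (2 * q + 1 + j)) /
             (INR (fact (S q)) * INR (fact (S q + j))))%R
  end.

(** For the Catalan series C = 1 + x C^2 this compares the coefficients of x^(p+1) in C^(j+1) = C^j
    + x C^(j+2). *)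
Lemma ballot_recurrence (j p : nat) :
  ballot (S j) (S p) = (ballot j (S p) + ballot (S (S j)) p)%R.
Proof.
destruct p as [|p]; unfold ballot.
- replace (2 * 0 + 1 + S j)%nat with (S (S j)) by lia.
  replace (2 * 0 + 1 + j)%nat with (S j) by lia.
  replace (1 + S j)%nat with (S (S j)) by lia.
  replace (1 + j)%nat with (S j) by lia.
  rewrite !fact_simpl, !mult_INR, !S_INR; simpl (INR 0); simpl (fact 0).
  rewrite INR_1; pose proof (pos_INR j); pose proof (INR_fact_neq_0 j).
  field; repeat split; lra.
- replace (2 * S p + 1 + S j)%nat with (S (2 * S p + 1 + j)) by lia.
  replace (2 * p + 1 + S (S j))%nat with (2 * S p + 1 + j)%nat by lia.
  replace (S (S p) + S j)%nat with (S (S (S p) + j)) by lia.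
  replace (S p + S (S j))%nat with (S (S (S p) + j)) by lia.
  rewrite (fact_simpl (2 * S p + 1 + j)), (fact_simpl (S (S p) + j)).
  rewrite (fact_simpl (S p)), !mult_INR, !S_INR, !plus_INR, !mult_INR, !S_INR.
  pose proof (pos_INR j); pose proof (pos_INR p); simpl (INR 0); simpl (INR 1).
  field; repeat split; try apply INR_fact_neq_0; lra.
Qed.

Lemma ballot_0_S (p : nat) : ballot 0 (S p) = 0%R.
Proof. unfold ballot, Rdiv; simpl (INR 0); ring. Qed.

(** In generating functions: C^j / sqrt(1 - 4x) is the sum of binom(2m + j, m) x^m. The recurrence
    splits the left side as Pascal's rule splits the right. *)
Lemma ballot_convolution (m j : nat) :
  sum_n (fun p => ballot j p * INR (binom (2 * (m - p)) (m - p))) m =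
  RtoC (INR (binom (2 * m + j) m)).
Proof.
revert j; induction m as [|m IHm]; intros j.
{ rewrite sum_O, !binom_n_0; apply Cmult_1_l. }
induction j as [|j IHj].
- rewrite Csum_Sl, Nat.add_0_r, Nat.sub_0_r.
  (* The zero is written [0 * 0] so that [Csum_mult_l] can pull it out. *)
  rewrite (Csum_ext _ (fun k => 0 * 0)) by
    (intros k _; rewrite ballot_0_S; Cring).
  rewrite Csum_mult_l; simpl ballot; Cring.
- rewrite Csum_Sl.
  rewrite (Csum_ext _ (fun k =>
     ballot j (S k) * INR (binom (2 * (S m - S k)) (S m - S k)) +
     ballot (S (S j)) k * INR (binom (2 * (m - k)) (m - k)))).
  2:{ intros k _; rewrite ballot_recurrence, RtoC_plus; simpl Nat.sub; Cring. }
  rewrite Csum_plus, IHm, Cplus_assoc.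
  (* Both values are 1, so the leading term completes the first sum to the one for [j]. *)
  change (RtoC (ballot (S j) 0)) with (RtoC (ballot j 0)).
  rewrite <- (Csum_Sl (fun k =>
    ballot j k * INR (binom (2 * (S m - k)) (S m - k)))), IHj.
  replace (2 * S m + S j)%nat with (S (2 * S m + j)) by lia.
  rewrite binom_S_S, plus_INR, RtoC_plus, Cplus_comm.
  do 4 f_equal; lia.
Qed.

(** * Absolutely convergent complex series *)

Notation is_Cseries := (@is_series C_AbsRing C_NormedModule).

Lemma Csum_Re_Im (f : nat -> C) (n : nat) :
  sum_n f n = (sum_n (fun k => Re (f k)) n, sum_n (fun k => Im (f k)) n).
Proof.
induction n as [|n IH].
- now rewrite !sum_O, <- surjective_pairing.
- now rewrite !sum_Sn, IH.
Qed.

Lemma is_Cseries_Re_Im (f : nat -> C) (v : C) :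
  is_Cseries f v <->
  is_series (fun k => Re (f k)) (Re v) /\ is_series (fun k => Im (f k)) (Im v).
Proof.
unfold is_series.
pose proof (filterlim_locally (U := C_UniformSpace) (F := eventually)
              (sum_n f) v) as HC.
pose proof (fun (g : nat -> R) (x : R) =>
  filterlim_locally (U := R_UniformSpace) (F := eventually) (sum_n g) x) as HR.
split.
- intros H; pose proof (proj1 HC H) as H'; split; apply HR;
    intros eps; generalize (H' eps); apply filter_imp; intros n Hn;
    rewrite Csum_Re_Im in Hn; apply Hn.
- intros [H1 H2]; apply HC; intros eps.
  generalize (filter_and _ _ (proj1 (HR _ _) H1 eps) (proj1 (HR _ _) H2 eps)).
  apply filter_imp; intros n Hn; rewrite Csum_Re_Im; exact Hn.
Qed.

(** Absolute convergence travels with the value so that Cauchy products can be iterated. *)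
Definition is_abs_series (f : nat -> C) (v : C) : Prop :=
  is_Cseries f v /\ ex_series (fun n => Cmod (f n)).

Lemma ex_series_Rle (a b : nat -> R) :
  (forall n, Rabs (a n) <= b n)%R -> ex_series b -> ex_series a.
Proof. exact (ex_series_le (V := R_CompleteNormedModule) a b). Qed.

Lemma im_le_Cmod (c : C) : (Rabs (Im c) <= Cmod c)%R.
Proof.
apply Rle_trans with (2 := Rmax_Cmod c), Rmax_r.
Qed.

Lemma ex_series_abs_Re (f : nat -> C) :
  ex_series (fun n => Cmod (f n)) -> ex_series (fun n => Rabs (Re (f n))).
Proof.
apply ex_series_Rle; intros n; rewrite Rabs_Rabsolu; apply re_le_Cmod.
Qed.

Lemma ex_series_abs_Im (f : nat -> C) :
  ex_series (fun n => Cmod (f n)) -> ex_series (fun n => Rabs (Im (f n))).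
Proof.
apply ex_series_Rle; intros n; rewrite Rabs_Rabsolu; apply im_le_Cmod.
Qed.

Lemma ex_abs_series (f : nat -> C) :
  ex_series (fun n => Cmod (f n)) -> exists v, is_abs_series f v.
Proof.
intros H.
destruct (ex_series_Rabs _ (ex_series_abs_Re f H)) as [x Hx].
destruct (ex_series_Rabs _ (ex_series_abs_Im f H)) as [y Hy].
exists (x, y); split; [|exact H]; now apply is_Cseries_Re_Im.
Qed.

Lemma is_abs_series_ext (f g : nat -> C) (v : C) :
  (forall n, f n = g n) -> is_abs_series f v -> is_abs_series g v.
Proof.
intros E [H1 H2]; split; [now apply (is_series_ext f)|].
apply ex_series_ext with (2 := H2); intros n; now rewrite E.
Qed.

Lemma Cmod_sum (f : nat -> C) (n : nat) :
  (Cmod (sum_n f n) <= sum_n (fun k => Cmod (f k)) n)%R.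
Proof. exact (norm_sum_n_m (V := C_NormedModule) f 0 n). Qed.

Lemma Re_sum (f : nat -> C) (n : nat) :
  Re (sum_n f n) = sum_n (fun k => Re (f k)) n.
Proof. now rewrite Csum_Re_Im. Qed.

Lemma Im_sum (f : nat -> C) (n : nat) :
  Im (sum_n f n) = sum_n (fun k => Im (f k)) n.
Proof. now rewrite Csum_Re_Im. Qed.

Lemma Rsum_minus (f g : nat -> R) (n : nat) :
  sum_n (fun k => f k - g k)%R n = (sum_n f n - sum_n g n)%R.
Proof.
induction n as [|n IH]; [now rewrite !sum_O|].
rewrite !sum_Sn, IH; unfold plus; simpl; ring.
Qed.

(** Real and imaginary parts combine four real Cauchy products; the moduli are dominated by the
    Cauchy product of the two series of moduli. *)
Lemma is_abs_series_mult (a b : nat -> C) (u v : C) :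
  is_abs_series a u -> is_abs_series b v ->
  is_abs_series (fun n => sum_n (fun k => a k * b (n - k)%nat) n) (u * v).
Proof.
intros [Ha Aa] [Hb Ab]; split.
- apply is_Cseries_Re_Im in Ha; destruct Ha as [Ha1 Ha2].
  apply is_Cseries_Re_Im in Hb; destruct Hb as [Hb1 Hb2].
  pose proof (ex_series_abs_Re _ Aa); pose proof (ex_series_abs_Im _ Aa).
  pose proof (ex_series_abs_Re _ Ab); pose proof (ex_series_abs_Im _ Ab).
  apply is_Cseries_Re_Im; split.
  + eapply is_series_ext; [|apply (is_series_minus _ _ _ _
      (is_series_mult _ _ _ _ Ha1 Hb1 ltac:(assumption) ltac:(assumption))
      (is_series_mult _ _ _ _ Ha2 Hb2 ltac:(assumption) ltac:(assumption)))].
    intros n; rewrite Re_sum, <- !sum_n_Reals; symmetry.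
    apply (Rsum_minus (fun k => Re (a k) * Re (b (n - k)%nat))%R
                      (fun k => Im (a k) * Im (b (n - k)%nat))%R).
  + eapply is_series_ext; [|apply (is_series_plus _ _ _ _
      (is_series_mult _ _ _ _ Ha1 Hb2 ltac:(assumption) ltac:(assumption))
      (is_series_mult _ _ _ _ Ha2 Hb1 ltac:(assumption) ltac:(assumption)))].
    intros n; rewrite Im_sum, <- !sum_n_Reals.
    rewrite <- sum_n_plus; apply sum_n_ext; intros k; reflexivity.
- destruct Aa as [x Hx], Ab as [y Hy].
  assert (Rx : ex_series (fun n => Rabs (Cmod (a n)))).
  { exists x; eapply is_series_ext; [|exact Hx].
    intros n; now rewrite Rabs_pos_eq by apply Cmod_ge_0. }
  assert (Ry : ex_series (fun n => Rabs (Cmod (b n)))).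
  { exists y; eapply is_series_ext; [|exact Hy].
    intros n; now rewrite Rabs_pos_eq by apply Cmod_ge_0. }
  apply ex_series_Rle with
    (b := fun n => sum_f_R0 (fun k => Cmod (a k) * Cmod (b (n - k)%nat))%R n).
  + intros n; rewrite Rabs_pos_eq by apply Cmod_ge_0.
    rewrite <- sum_n_Reals; eapply Rle_trans; [apply Cmod_sum|].
    apply Req_le, sum_n_ext; intros k; apply Cmod_mult.
  + eexists; exact (is_series_mult _ _ _ _ Hx Hy Rx Ry).
Qed.

Lemma is_series_finite {K : AbsRing} {V : NormedModule K}
    (a : nat -> V) (N : nat) :
  (forall n, (N < n)%nat -> a n = zero) -> is_series a (sum_n a N).
Proof.
intros H; unfold is_series.
apply filterlim_ext_loc with (fun _ => sum_n a N); [|apply filterlim_const].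
exists N; intros n Hn.
induction Hn as [|n Hn IH]; [reflexivity|].
rewrite sum_Sn, H, plus_zero_r by lia; exact IH.
Qed.

(** * The binomial series *)

(** These terms expand (1 - z)^(-b); note the sign of the exponent. *)
Definition binomial_term (b z : C) (k : nat) : C :=
  Cpoch b k / INR (fact k) * z ^ k.

Lemma INR_fact_C_neq_0 (n : nat) : RtoC (INR (fact n)) <> 0.
Proof. intros H; apply (INR_fact_neq_0 n), RtoC_inj, H. Qed.

Lemma binomial_term_mult (a b z : C) (n : nat) :
  sum_n (fun k => binomial_term a z k * binomial_term b z (n - k)) n =
  binomial_term (a + b) z n.
Proof.
unfold binomial_term at 3; rewrite <- Cpoch_vandermonde.
unfold Cdiv; rewrite Cmult_comm, (Cmult_comm _ (/ _)), Cmult_assoc.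
rewrite <- Csum_mult_l; apply Csum_ext; intros k Hk.
unfold binomial_term; rewrite INR_binom, RtoC_div, RtoC_mult by
  (try exact Hk; apply Rmult_integral_contrapositive; split;
   apply INR_fact_neq_0).
replace (z ^ n) with (z ^ k * z ^ (n - k))
  by (rewrite <- Cpow_add_r; f_equal; lia).
Cfield; repeat split; apply INR_fact_C_neq_0.
Qed.

Lemma is_abs_series_binomial_plus (a b z u v : C) :
  is_abs_series (binomial_term a z) u -> is_abs_series (binomial_term b z) v ->
  is_abs_series (binomial_term (a + b) z) (u * v).
Proof.
intros Ha Hb; eapply is_abs_series_ext;
  [|exact (is_abs_series_mult _ _ _ _ Ha Hb)].
intros n; apply binomial_term_mult.
Qed.

Lemma Cpoch_0_S (n : nat) : Cpoch 0 (S n) = 0.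
Proof. rewrite Cpoch_Sl; ring. Qed.

Lemma is_abs_series_binomial_0 (z : C) : is_abs_series (binomial_term 0 z) 1.
Proof.
assert (H : forall n, (0 < n)%nat -> binomial_term 0 z n = 0).
{ intros [|n] Hn; [lia|]; unfold binomial_term; rewrite Cpoch_0_S.
  unfold Cdiv; ring. }
split.
- replace (RtoC 1) with (sum_n (binomial_term 0 z) 0).
  + now apply (is_series_finite (V := C_NormedModule)).
  + rewrite sum_O; unfold binomial_term; simpl; Cfield; apply C1_nz.
- eexists; apply (is_series_finite (V := R_NormedModule) (fun n => Cmod (binomial_term 0 z n)) 0).
  intros n Hn; rewrite H by exact Hn; apply Cmod_0.
Qed.

Lemma is_abs_series_binomial_m1 (z : C) :
  is_abs_series (binomial_term (- (1)) z) (1 - z).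
Proof.
assert (H : forall n, (1 < n)%nat -> binomial_term (- (1)) z n = 0).
{ intros [|[|n]] Hn; try lia; unfold binomial_term.
  rewrite Cpoch_Sl; replace (- (1) + 1) with (RtoC 0) by ring.
  rewrite Cpoch_0_S; unfold Cdiv; ring. }
split.
- replace (1 - z) with (sum_n (binomial_term (- (1)) z) 1 : C).
  + now apply (is_series_finite (V := C_NormedModule)).
  + rewrite Csum_S, sum_O; unfold binomial_term; simpl; Cfield; apply C1_nz.
- eexists.
  apply (is_series_finite (V := R_NormedModule) (fun n => Cmod (binomial_term (- (1)) z n)) 1).
  intros n Hn; rewrite H by exact Hn; apply Cmod_0.
Qed.

Lemma is_abs_series_unique (f : nat -> C) (u v : C) :
  is_abs_series f u -> is_abs_series f v -> u = v.
Proof.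
intros [H1 _] [H2 _].
apply is_Cseries_Re_Im in H1, H2; destruct H1 as [H1 H1'], H2 as [H2 H2'].
apply is_series_unique in H1, H1', H2, H2'.
destruct u as [u1 u2], v as [v1 v2]; simpl in *; congruence.
Qed.

Lemma ex_abs_series_bounded_coef (c : nat -> C) (z : C) :
  (Cmod z < 1)%R -> (forall n, Cmod (c n) <= 1)%R ->
  exists v, is_abs_series (fun n => c n * z ^ n) v.
Proof.
intros Hz Hc; apply ex_abs_series.
apply ex_series_Rle with (b := fun n => (Cmod z ^ n)%R).
- intros n; rewrite Rabs_pos_eq, Cmod_mult, Cmod_pow by apply Cmod_ge_0.
  rewrite <- (Rmult_1_l (Cmod z ^ n)) at 2; apply Rmult_le_compat_r, Hc.
  apply pow_le, Cmod_ge_0.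
- exists (/ (1 - Cmod z))%R; apply is_series_geom.
  now rewrite Rabs_pos_eq by apply Cmod_ge_0.
Qed.

Lemma Cpoch_1 (n : nat) : Cpoch 1 n = INR (fact n).
Proof.
induction n as [|n IH]; [reflexivity|].
rewrite fact_simpl, mult_INR, RtoC_mult, INR_C_S; simpl; rewrite IH; ring.
Qed.

Lemma one_minus_neq_0 (z : C) : (Cmod z < 1)%R -> 1 - z <> 0.
Proof.
intros Hz E; apply Ceq_minus in E; rewrite <- E, Cmod_1 in Hz; lra.
Qed.

(** The sum exists by comparison with a geometric series; times 1 - z it is the sum for exponent 0,
    which is 1. *)
Lemma is_abs_series_binomial_1 (z : C) : (Cmod z < 1)%R ->
  is_abs_series (binomial_term 1 z) (/ (1 - z)).
Proof.
intros Hz.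
destruct (ex_abs_series_bounded_coef (fun n => Cpoch 1 n / INR (fact n)) z Hz)
  as [v Hv].
{ intros n; rewrite Cpoch_1; apply Req_le; rewrite <- Cmod_1; f_equal.
  field; apply INR_fact_C_neq_0. }
replace (/ (1 - z)) with v; [exact Hv|].
assert (E : v * (1 - z) = 1).
{ apply (is_abs_series_unique (binomial_term 0 z));
    [|apply is_abs_series_binomial_0].
  replace (RtoC 0) with (1 + - (1)) by ring.
  exact (is_abs_series_binomial_plus _ _ _ _ _ Hv
           (is_abs_series_binomial_m1 z)). }
assert (Hz1 := one_minus_neq_0 z Hz).
replace v with (v * (1 - z) * / (1 - z)) by (field; exact Hz1).
rewrite E; ring.
Qed.

Lemma RtoC_2_neq_0 : RtoC 2 <> 0.
Proof. intros E; apply RtoC_inj in E; lra. Qed.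

(** * Taylor coefficients of the square root of 1 - z *)

Fixpoint sqrt_coef (k : nat) : R :=
  match k with
  | O => 1
  | S p => (sqrt_coef p * ((INR p - / 2) / (INR p + 1)))%R
  end.

Lemma Cpoch_sqrt_coef (k : nat) :
  Cpoch (- (1 / 2)) k / INR (fact k) = sqrt_coef k.
Proof.
induction k as [|k IH]; [simpl; field; apply C1_nz|].
assert (Hk : (INR k + 1 <> 0)%R) by (pose proof (pos_INR k); lra).
assert (Hk' : INR k + 1 <> 0).
{ intros E; apply Hk, RtoC_inj; rewrite RtoC_plus; exact E. }
simpl sqrt_coef.
rewrite RtoC_mult, <- IH, RtoC_div, RtoC_minus, RtoC_inv, RtoC_plus
  by (exact Hk || lra).
rewrite fact_simpl, mult_INR, RtoC_mult, INR_C_S; simpl Cpoch.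
field; auto using INR_fact_C_neq_0, RtoC_2_neq_0.
Qed.

Lemma sqrt_coef_bound (k : nat) : (Rabs (sqrt_coef k) <= 1)%R.
Proof.
induction k as [|k IH]; simpl; [rewrite Rabs_R1; lra|].
rewrite Rabs_mult, <- (Rmult_1_r 1).
apply Rmult_le_compat; try apply Rabs_pos; [exact IH|].
pose proof (pos_INR k); apply Rabs_le; split.
- apply Rle_div_r; lra.
- apply Rle_div_l; lra.
Qed.

Lemma sqrt_coef_S_neg (k : nat) : (sqrt_coef (S k) <= 0)%R.
Proof.
induction k as [|k IH]; [simpl; lra|].
change (sqrt_coef (S k) * ((INR (S k) - / 2) / (INR (S k) + 1)) <= 0)%R.
rewrite S_INR; pose proof (pos_INR k).
assert (0 <= (INR k + 1 - / 2) / (INR k + 1 + 1))%R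
  by (apply Rdiv_le_0_compat; lra).
nra.
Qed.

(** The partial sums are the coefficients of (1 - z)^(-1/2). This closed form shows that they are
    nonnegative, since [sqrt_coef (S n) <= 0]. *)
Lemma sum_sqrt_coef (n : nat) :
  sum_n sqrt_coef n = (- (2 * (INR n + 1)) * sqrt_coef (S n))%R.
Proof.
induction n as [|n IH].
- rewrite sum_O; simpl; field.
- rewrite sum_Sn, IH.
  change (- (2 * (INR n + 1)) * sqrt_coef (S n) + sqrt_coef (S n) =
    - (2 * (INR (S n) + 1)) *
      (sqrt_coef (S n) * ((INR (S n) - / 2) / (INR (S n) + 1))))%R.
  rewrite S_INR; pose proof (pos_INR n); field; lra.
Qed.

Lemma sum_sqrt_coef_pos (n : nat) : (0 <= sum_n sqrt_coef n)%R.
Proof.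
rewrite sum_sqrt_coef; pose proof (sqrt_coef_S_neg n); pose proof (pos_INR n).
nra.
Qed.

(* All coefficients but the first are nonpositive, and their partial sums are
   at least -1. *)
Lemma Re_sqrt_partial_sum (z : C) (n : nat) : (Cmod z < 1)%R ->
  (1 - Cmod z + Cmod z * sum_n sqrt_coef n <=
   Re (sum_n (fun k => RtoC (sqrt_coef k) * z ^ k)%C n))%R.
Proof.
intros Hz; pose proof (Cmod_ge_0 z) as Hz0.
induction n as [|n IH].
- rewrite !sum_O; simpl; lra.
- rewrite Csum_S, sum_Sn; unfold plus; simpl AbelianMonoid.plus.
  change (1 - Cmod z + Cmod z * (sum_n sqrt_coef n + sqrt_coef (S n)) <=
    Re (sum_n (fun k => RtoC (sqrt_coef k) * z ^ k)%C n) +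
    Re (RtoC (sqrt_coef (S n)) * z ^ S n)%C)%R.
  rewrite re_scal_l.
  pose proof (sqrt_coef_S_neg n) as Hw; set (w := sqrt_coef (S n)) in *.
  (* As [w <= 0], the bound Re z^(n+1) <= |z|^(n+1) <= |z| gives w Re z^(n+1) >= w |z|. *)
  pose proof (re_le_Cmod (z ^ S n)) as Hr; rewrite Cmod_pow in Hr.
  apply Rabs_le_between in Hr.
  assert (Cmod z ^ S n <= Cmod z)%R.
  { simpl; rewrite <- (Rmult_1_r (Cmod z)) at 3.
    apply Rmult_le_compat_l; [exact Hz0|].
    rewrite <- (pow1 n); apply pow_incr; lra. }
  nra.
Qed.

(** * Complex exponential and principal powers *)

Lemma Cexp_plus (x y : C) : Cexp (x + y) = Cexp x * Cexp y.
Proof.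
unfold Cexp; destruct x as [a b], y as [c d]; simpl.
rewrite exp_plus, cos_plus, sin_plus; unfold Cmult; simpl; f_equal; ring.
Qed.

Lemma Cexp_0 : Cexp 0 = 1.
Proof. unfold Cexp; simpl; now rewrite exp_0, cos_0, sin_0, Rmult_1_r, Rmult_0_r. Qed.

Lemma Cexp_neq_0 (x : C) : Cexp x <> 0.
Proof.
intros E; pose proof Cexp_0 as H.
replace (RtoC 0) with (x + - x) in H by ring.
rewrite Cexp_plus, E, Cmult_0_l in H; now apply C1_nz.
Qed.

Lemma Cexp_opp (x : C) : Cexp (- x) = / Cexp x.
Proof.
pose proof (Cexp_neq_0 x) as H.
replace (Cexp (- x)) with (Cexp (x + - x) / Cexp x)
  by (rewrite Cexp_plus; field; exact H).
rewrite Cplus_opp_r, Cexp_0; field; exact H.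
Qed.

Lemma Cpower_exp (w a : C) : w <> 0 -> Cpower w a = Cexp (a * Clog w).
Proof. intros H; unfold Cpower; now destruct (Ceq_dec w 0). Qed.

Lemma Csqrt_sqr (w : C) : Csqrt w * Csqrt w = w.
Proof.
unfold Csqrt; destruct (Ceq_dec w 0) as [->|H].
- unfold Cpower; destruct (Ceq_dec 0 0) as [_|H]; [|now destruct H].
  destruct (Ceq_dec (1 / 2) 0) as [E|_]; [|ring].
  exfalso; apply C1_nz; replace (RtoC 1) with (1 / 2 * 2)
    by (field; apply RtoC_2_neq_0); rewrite E; ring.
- rewrite Cpower_exp, <- Cexp_plus by exact H.
  replace (1 / 2 * Clog w + 1 / 2 * Clog w) with (Clog w)
    by (field; apply RtoC_2_neq_0).
  now apply Cexp_Clog.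
Qed.

(** Half of the principal argument lies in (-PI/2, PI/2], where the cosine is nonnegative. *)
Lemma Re_Cexp_half_Clog (w : C) : w <> 0 -> (0 <= Re (Cexp (1 / 2 * Clog w)))%R.
Proof.
intros H; pose proof (Carg_bounds w H) as [H1 H2].
rewrite <- RtoC_div by lra; simpl.
apply Rmult_le_pos; [apply Rlt_le, exp_pos|].
apply cos_ge_0; lra.
Qed.

(* The sum g satisfies g^2 = 1 - z and Re g > 0, which selects the principal
   root. *)
Lemma is_abs_series_binomial_sqrt (z : C) : (Cmod z < 1)%R ->
  is_abs_series (binomial_term (- (1 / 2)) z) (Cexp (1 / 2 * Clog (1 - z))).
Proof.
intros Hz; assert (Hz1 := one_minus_neq_0 z Hz).
destruct (ex_abs_series_bounded_coef (fun n => RtoC (sqrt_coef n)) z Hz)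
  as [g Hg].
{ intros n; rewrite Cmod_R; apply sqrt_coef_bound. }
assert (Hpos : (0 < Re g)%R).
(* Every partial sum has real part at least 1 - |z|, and the bound passes to the limit. *)
{ apply Rlt_le_trans with (1 - Cmod z)%R; [lra|].
  destruct Hg as [Hg _]; apply is_Cseries_Re_Im in Hg; destruct Hg as [Hg _].
  apply (is_lim_seq_le (fun _ => (1 - Cmod z)%R)
    (sum_n (fun k => Re (RtoC (sqrt_coef k) * z ^ k)))
    (Finite (1 - Cmod z)) (Finite (Re g))).
  - intros n; rewrite <- Re_sum.
    pose proof (Re_sqrt_partial_sum z n Hz); pose proof (sum_sqrt_coef_pos n).
    pose proof (Cmod_ge_0 z); nra.
  - apply is_lim_seq_const.
  - exact Hg. }
assert (Hb : is_abs_series (binomial_term (- (1 / 2)) z) g).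
{ apply is_abs_series_ext with (2 := Hg); intros n.
  unfold binomial_term; now rewrite Cpoch_sqrt_coef. }
pose proof (is_abs_series_binomial_plus _ _ _ _ _ Hb Hb) as Hgg.
replace (- (1 / 2) + - (1 / 2)) with (- (1)) in Hgg
  by (field; apply RtoC_2_neq_0).
pose proof (is_abs_series_unique _ _ _ Hgg (is_abs_series_binomial_m1 z)) as E.
set (r := Cexp (1 / 2 * Clog (1 - z))).
assert (Hr : r * r = 1 - z).
{ pose proof (Csqrt_sqr (1 - z)) as E'; unfold Csqrt in E'.
  now rewrite Cpower_exp in E' by exact Hz1. }
assert (E0 : (g - r) * (g + r) = 0).
{ replace ((g - r) * (g + r)) with (g * g - r * r) by ring.
  rewrite E, Hr; ring. }
destruct (Ceq_dec (g - r) 0) as [D|D].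
{ replace r with g; [exact Hb|]; now apply Ceq_minus. }
destruct (Ceq_dec (g + r) 0) as [D'|D']; [exfalso|].
(* The other root g = -r would force Re g <= 0. *)
- pose proof (Re_Cexp_half_Clog (1 - z) Hz1) as Hr0; fold r in Hr0.
  apply (f_equal Re) in D'; change (Re g + Re r = 0)%R in D'; lra.
- exfalso; now apply (Cmult_neq_0 _ _ D D').
Qed.

(** With [Cexp] and one fixed logarithm, exponents add without branch corrections. *)
Definition binomial_sum_at (z b : C) : Prop :=
  is_abs_series (binomial_term b z) (Cexp (- b * Clog (1 - z))).

Lemma binomial_sum_at_plus (z a b : C) :
  binomial_sum_at z a -> binomial_sum_at z b -> binomial_sum_at z (a + b).
Proof.
unfold binomial_sum_at; intros Ha Hb.
replace (- (a + b) * Clog (1 - z))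
  with (- a * Clog (1 - z) + - b * Clog (1 - z)) by ring.
rewrite Cexp_plus; now apply is_abs_series_binomial_plus.
Qed.

Lemma binomial_sum_at_nat (z b : C) (n : nat) :
  binomial_sum_at z b -> binomial_sum_at z (INR n * b).
Proof.
intros Hb; induction n as [|n IH].
- replace (INR 0 * b) with (RtoC 0) by (simpl; ring); unfold binomial_sum_at.
  replace (- 0 * Clog (1 - z)) with (RtoC 0) by ring.
  rewrite Cexp_0; apply is_abs_series_binomial_0.
- rewrite INR_C_S; replace ((INR n + 1) * b) with (INR n * b + b) by ring.
  now apply binomial_sum_at_plus.
Qed.

Lemma binomial_sum_at_1 (z : C) : (Cmod z < 1)%R -> binomial_sum_at z 1.
Proof.
intros Hz; unfold binomial_sum_at.
replace (- (1) * Clog (1 - z)) with (- Clog (1 - z)) by ring.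
rewrite Cexp_opp, Cexp_Clog by now apply one_minus_neq_0.
now apply is_abs_series_binomial_1.
Qed.

Lemma binomial_sum_at_half (z : C) (n m : nat) : (Cmod z < 1)%R ->
  binomial_sum_at z (1 / 2 - INR n / 2 + INR m).
Proof.
intros Hz.
(* The exponent is made of n + 1 copies of -1/2 and m + 1 copies of 1. *)
replace (1 / 2 - INR n / 2 + INR m)
  with (INR (S n) * - (1 / 2) + INR (S m) * 1)
  by (rewrite !INR_C_S; field; apply RtoC_2_neq_0).
apply binomial_sum_at_plus; apply binomial_sum_at_nat.
- unfold binomial_sum_at; replace (- - (1 / 2)) with (1 / 2) by ring.
  now apply is_abs_series_binomial_sqrt.
- now apply binomial_sum_at_1.
Qed.

(** * The terminating hypergeometric series *)

Lemma is_Cseries_shift (f : nat -> C) (v : C) (m : nat) :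
  is_Cseries f v ->
  is_Cseries (fun r => if (m <=? r)%nat then f (r - m)%nat else RtoC 0) v.
Proof.
intros H; destruct m as [|m].
- apply (is_series_ext f); [|exact H]; intros n; simpl; now rewrite Nat.sub_0_r.
- apply (is_series_decr_n (V := C_NormedModule)) with (n := S m); [lia|].
  match goal with |- is_series _ (plus v (opp ?x)) => replace x with (RtoC 0) end.
  + change (is_Cseries (fun k => if (S m <=? S m + k)%nat
      then f (S m + k - S m)%nat else RtoC 0) (v + - 0)).
    replace (v + - 0) with v by ring.
    apply (is_series_ext f); [|exact H]; intros n.
    rewrite (proj2 (Nat.leb_le _ _)) by lia; f_equal; lia.
  + symmetry; rewrite (Csum_ext _ (fun _ => 0 * 0)).
    * rewrite Csum_mult_l; apply Cmult_0_l.
    * intros k Hk; rewrite (proj2 (Nat.leb_gt _ _)) by (simpl in Hk; lia); Cring.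
Qed.

(** As the transformed series terminates, interchanging the summations needs only this finite
    additivity. *)
Lemma is_Cseries_sum (F : nat -> nat -> C) (v : nat -> C) (n : nat) :
  (forall m, (m <= n)%nat -> is_Cseries (F m) (v m)) ->
  is_Cseries (fun r => sum_n (fun m => F m r) n) (sum_n v n).
Proof.
induction n as [|n IH]; intros H.
- rewrite sum_O; apply (is_series_ext (F O)); [|now apply H].
  intros r; now rewrite sum_O.
- rewrite sum_Sn.
  apply (is_series_ext
    (fun r => plus (sum_n (fun m => F m r) n) (F (S n) r) : C_NormedModule)).
  + intros r; now rewrite sum_Sn.
  + apply (is_series_plus (V := C_NormedModule)); auto.
Qed.

Lemma Csum_zero_tail (f : nat -> C) (n p : nat) :
  (forall k, (n < k)%nat -> f k = 0) -> sum_n f (n + p) = sum_n f n.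
Proof.
intros H; induction p as [|p IH]; [now rewrite Nat.add_0_r|].
rewrite Nat.add_succ_r, Csum_S, IH, H by lia; Cring.
Qed.

Section Pfaff.

Variables (N : nat).
Let a : C := 1 / 2 - INR N / 2.
(** This is [c - a], the second upper parameter after the Pfaff transformation. *)
Let e : C := - (INR N / 2).
Let c : C := 1 / 2 - INR N.

(** A zero would give 1 + 2k = 2N, against parity. *)
Lemma half_integer_neq_0 (k : nat) : c + INR k <> 0.
Proof.
unfold c; rewrite <- RtoC_div, <- RtoC_minus, <- RtoC_plus by lra.
intros E; apply RtoC_inj in E.
assert (E2 : INR (1 + 2 * k) = INR (2 * N)).
{ rewrite plus_INR, !mult_INR; simpl (INR 2); simpl (INR 1); lra. }
apply INR_eq in E2; lia.
Qed.

(** The ratio of consecutive Legendre coefficients, cross-multiplied because binom(2(N - m), N)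
    vanishes when 2(N - m) < N. *)
Lemma legendre_coef_step (m : nat) : (m < N)%nat ->
  (INR (binom N (S m)) * INR (binom (2 * (N - S m)) N) *
     (INR m + 1) * (1 / 2 - INR N + INR m) =
   - (INR (binom N m) * INR (binom (2 * (N - m)) N)) *
     ((1 / 2 - INR N / 2 + INR m) * (- (INR N / 2) + INR m)))%R.
Proof.
intros Hm.
pose proof (binom_absorb_bot N m) as E1.
set (t := (N - S m)%nat).
replace (2 * (N - m))%nat with (S (S (2 * t))) by (unfold t; lia).
pose proof (binom_absorb_top (2 * t) N) as E2.
pose proof (binom_absorb_top (S (2 * t)) N) as E3.
assert (Et : (INR N = INR t + INR m + 1)%R).
{ replace N with (S (t + m)) at 1 by (unfold t; lia).
  now rewrite S_INR, plus_INR. }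
rewrite S_INR, mult_INR in E3; rewrite mult_INR in E2.
change (INR 2) with (1 + 1)%R in *.
set (B0 := INR (binom (2 * t) N)) in *.
set (B1 := INR (binom (S (2 * t)) N)) in *.
set (B2 := INR (binom (S (S (2 * t))) N)) in *.
set (x := INR (binom N m)) in *; set (y := INR (binom N (S m))) in *.
transitivity (((INR N - INR m) * x) * B0 * (1 / 2 - INR N + INR m))%R.
{ rewrite <- E1; ring. }
(* The factors 2t + 2 - N and 2t + 1 - N are -2(e + m) and -2(a + m), whence the division by 4. *)
transitivity (- (x / 4) * ((B2 * ((1 + 1) * INR t + 1 + 1 - INR N)) *
   ((1 + 1) * INR t + 1 - INR N)))%R.
2: { rewrite Et; field. }
rewrite E3.
transitivity (- (x / 4) * (((1 + 1) * INR t + 1 + 1) *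
   (B1 * ((1 + 1) * INR t + 1 - INR N))))%R.
2: { ring. }
rewrite E2, Et; field.
Qed.

Lemma legendre_coef_pochhammer (m : nat) : (m <= N)%nat ->
  INR (binom N m) * ((- (1)) ^ m * INR (binom (2 * (N - m)) N)) *
    (Cpoch c m * INR (fact m)) =
  INR (binom (2 * N) N) * (Cpoch a m * Cpoch e m).
Proof.
induction m as [|m IH]; intros Hm.
- rewrite binom_n_0, Nat.sub_0_r; simpl Cpoch; simpl fact; simpl INR at 1 3.
  simpl Cpow; ring.
- specialize (IH ltac:(lia)).
  pose proof (f_equal RtoC (legendre_coef_step m Hm)) as E.
  repeat rewrite ?RtoC_mult, ?RtoC_plus, ?RtoC_minus, ?RtoC_opp in E.
  rewrite !RtoC_div in E by lra.
  fold c in E; fold a in E; fold e in E.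
  rewrite fact_simpl, mult_INR, RtoC_mult, INR_C_S, Cpow_S; simpl Cpoch.
  transitivity (- ((- (1)) ^ m * (Cpoch c m * INR (fact m))) *
    (INR (binom N (S m)) * INR (binom (2 * (N - S m)) N) * (INR m + 1) *
     (c + INR m))); [ring|].
  rewrite E.
  transitivity ((INR (binom (2 * N) N) * (Cpoch a m * Cpoch e m)) *
    ((a + INR m) * (e + INR m))); [rewrite <- IH|]; ring.
Qed.

Lemma Cpoch_neg_nat (u m : nat) : (u < m)%nat -> Cpoch (- INR u) m = 0.
Proof.
intros H; replace m with (S u + (m - S u))%nat by lia.
rewrite Cpoch_plus; simpl; ring.
Qed.

(** One upper parameter is a nonpositive integer: [e] for even [N], [a] for odd [N]. Hence the
    transformed series terminates. *)
Lemma Cpoch_half_vanish (m : nat) : (N < m)%nat -> Cpoch a m * Cpoch e m = 0.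
Proof.
intros H; destruct (Nat.Even_or_Odd N) as [[u Hu]|[u Hu]].
- replace e with (- INR u).
  + rewrite Cpoch_neg_nat by lia; ring.
  + unfold e; rewrite Hu, mult_INR, RtoC_mult; simpl (INR 2).
    replace (1 + 1)%R with 2%R by ring; field; apply RtoC_2_neq_0.
- replace a with (- INR u).
  + rewrite Cpoch_neg_nat by lia; ring.
  + unfold a; rewrite Hu, plus_INR, mult_INR, RtoC_plus, RtoC_mult.
    simpl (INR 2); simpl (INR 1).
    replace (1 + 1)%R with 2%R by ring; field; apply RtoC_2_neq_0.
Qed.

(* The Pfaff transformation z -> z / (z - 1), with s^2 = z / (z - 1); the
   transformed series terminates. *)
Lemma hyp2F1_legendre (z : C) : (Cmod z < 1)%R ->
  let s := Csqrt (z / (z - 1)) in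
  is_hyp2F1 a a c z
    (Cpower (1 - z) ((INR N - 1) / 2) / INR (binom (2 * N) N) * legendre N s).
Proof.
intros Hz s; assert (Hz1 := one_minus_neq_0 z Hz).
pose proof (central_binom_neq_0 N) as HB.
assert (Hc : forall m, Cpoch c m <> 0)
  by (intros m; apply Cpoch_neq_0, half_integer_neq_0).
(* Here [q] holds the coefficients of F(a, e; c; .), [v m] is the transformed term q_m (-z)^m (1 -
   z)^(-a-m), and [F m] is its expansion in powers of z. *)
set (q := fun m => Cpoch a m * Cpoch e m / (Cpoch c m * INR (fact m))).
set (L := Clog (1 - z)).
set (v := fun m => q m * (- z) ^ m * Cexp (- (a + INR m) * L)).
set (F := fun m r : nat => if (m <=? r)%nat then
   q m * (- z) ^ m * binomial_term (a + INR m) z (r - m) else RtoC 0).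
assert (HF : forall m, is_Cseries (F m) (v m)).
{ intros m.
  apply (is_Cseries_shift
    (fun r => q m * (- z) ^ m * binomial_term (a + INR m) z r) (v m) m).
  apply (is_series_scal_l (V := C_NormedModule)).
  exact (proj1 (binomial_sum_at_half z N m Hz)). }
pose proof (is_Cseries_sum F v N (fun m _ => HF m)) as HS.
replace (Cpower (1 - z) ((INR N - 1) / 2) / INR (binom (2 * N) N) * legendre N s)
  with (sum_n v N : C).
- apply is_series_ext with (2 := HS); intros r.
  (* Lengthen the range to [N + r], where [q] vanishes on the added terms, then cut it at [r],
     beyond which [F m r] is 0. *)
  rewrite <- (Csum_zero_tail _ N r).
  2: { intros k Hk; unfold F, q; destruct (k <=? r)%nat; [|reflexivity].
       rewrite Cpoch_half_vanish by exact Hk; unfold Cdiv; ring. }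
  rewrite Nat.add_comm, Csum_zero_tail.
  2: { intros k Hk; unfold F; now rewrite (proj2 (Nat.leb_gt _ _)). }
  transitivity (Cpoch a r / INR (fact r) * z ^ r * (Cpoch (c - e) r / Cpoch c r)).
  (* The coefficient of z^r is a Chu-Vandermonde sum with [d = e], and [c - e = a]. *)
  + rewrite <- chu_vandermonde by exact half_integer_neq_0.
    rewrite <- Csum_mult_l; apply Csum_ext; intros m Hm.
    unfold F, q, binomial_term; rewrite (proj2 (Nat.leb_le _ _)) by exact Hm.
    rewrite INR_binom, RtoC_div, RtoC_mult by
      (try exact Hm; apply Rmult_integral_contrapositive; split;
       apply INR_fact_neq_0).
    replace (Cpoch a r) with (Cpoch a m * Cpoch (a + INR m) (r - m))
      by (rewrite <- Cpoch_plus; f_equal; lia).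
    replace (z ^ r) with (z ^ m * z ^ (r - m))
      by (rewrite <- Cpow_add_r; f_equal; lia).
    rewrite Cpow_opp.
    Cfield; repeat split; auto using INR_fact_C_neq_0.
  + replace (c - e) with a; [Cfield; auto using INR_fact_C_neq_0|].
    unfold a, c, e; field; apply RtoC_2_neq_0.
- unfold legendre; rewrite <- Csum_mult_l; apply Csum_ext; intros m Hm.
  pose proof (legendre_coef_pochhammer m Hm) as E.
  assert (Eq : q m = INR (binom N m) *
    ((- (1)) ^ m * INR (binom (2 * (N - m)) N)) / INR (binom (2 * N) N)).
  { unfold q; replace (Cpoch a m * Cpoch e m) with
      (INR (binom (2 * N) N) * (Cpoch a m * Cpoch e m) / INR (binom (2 * N) N))
      by (field; exact HB).
    rewrite <- E; field; auto using INR_fact_C_neq_0. }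
  unfold v; rewrite Eq; unfold s; rewrite Csqrt_sqr, Cpower_exp by exact Hz1.
  (* The power splits into the common prefactor and (1 - z)^(-m), which joins (-z)^m to form
     (s^2)^m. *)
  replace (- (a + INR m) * L) with ((INR N - 1) / 2 * L + - (INR m * L))
    by (unfold a; field; apply RtoC_2_neq_0).
  assert (Em : Cexp (- (INR m * L)) = / (1 - z) ^ m).
  { clear - Hz1; unfold L; induction m as [|m IH].
    - simpl; rewrite Cmult_0_l, Cexp_opp, Cexp_0; reflexivity.
    - rewrite INR_C_S.
      replace (- ((INR m + 1) * Clog (1 - z)))
        with (- (INR m * Clog (1 - z)) + - Clog (1 - z)) by ring.
      rewrite Cexp_plus, IH, Cexp_opp, Cexp_Clog, Cpow_S by exact Hz1.
      field; auto using Cpow_nz. }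
  rewrite Cexp_plus, Em; fold L.
  replace (z / (z - 1)) with (- z * / (1 - z)).
  2: { field; split; [|exact Hz1]; intros D; apply Hz1.
       replace (1 - z) with (- (z - 1)) by ring; rewrite D; ring. }
  rewrite (Cpow_mult_l (- z)), Cpow_inv by exact Hz1.
  Cfield; auto using Cpow_nz.
Qed.

End Pfaff.

(** * The double sum *)

(** The even factors of (2p)! multiply to 2^p p!, the odd ones to the double factorial. *)
Lemma odd_dfact_fact (p : nat) :
  (INR (odd_dfact p) * 2 ^ p * INR (fact p) = INR (fact (2 * p)))%R.
Proof.
induction p as [|p IH]; [simpl; ring|].
replace (2 * S p)%nat with (S (S (2 * p))) by lia.
rewrite !fact_simpl, !mult_INR, <- IH, !S_INR, mult_INR.
change (odd_dfact (S p)) with ((2 * p + 1) * odd_dfact p)%nat.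
rewrite mult_INR, plus_INR, mult_INR; simpl; ring.
Qed.

(** With [k = j + p] and [j > 0] the binomial is (2p + j - 1)! / ((2p)! (j - 1)!), and
    [odd_dfact_fact] removes (2p)!. For [j = 0] the convention gives 1 at [p = 0] and 0 otherwise,
    as [ballot 0 p] does. *)
Lemma binomZ_ballot (j p : nat) :
  (INR (fact j) * INR (odd_dfact p) * 2 ^ p *
     binomZ (2 * Z.of_nat (j + p) - Z.of_nat j - 1) (Z.of_nat j - 1) =
   INR (fact (j + p)) * ballot j p)%R.
Proof.
pose proof (odd_dfact_fact p) as E.
destruct j as [|j].
{ destruct p as [|p]; [unfold binomZ; simpl; ring|].
  rewrite ballot_0_S; unfold binomZ.
  replace ((2 * Z.of_nat (0 + S p) - Z.of_nat 0 - 1 =? -1)%Z) with false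
    by (symmetry; apply Z.eqb_neq; lia).
  simpl andb; cbn [Z.of_nat]; simpl (0 - 1)%Z; simpl (0 <=? -1)%Z; ring. }
unfold binomZ.
replace (Z.of_nat (S j) - 1 =? -1)%Z with false by (symmetry; apply Z.eqb_neq; lia).
rewrite Bool.andb_false_r.
replace (0 <=? Z.of_nat (S j) - 1)%Z with true by (symmetry; apply Z.leb_le; lia).
replace (Z.of_nat (S j) - 1 <=? 2 * Z.of_nat (S j + p) - Z.of_nat (S j) - 1)%Z
  with true by (symmetry; apply Z.leb_le; lia).
simpl andb; cbv iota.
replace (Z.to_nat (2 * Z.of_nat (S j + p) - Z.of_nat (S j) - 1))
  with (2 * p + j)%nat by lia.
replace (Z.to_nat (Z.of_nat (S j) - 1)) with j by lia.
unfold Binomial.C; replace (2 * p + j - j)%nat with (2 * p)%nat by lia.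
rewrite <- E.
assert (INR (odd_dfact p) <> 0)%R.
{ intros D; apply (INR_fact_neq_0 (2 * p)); rewrite <- E, D; ring. }
assert (2 ^ p <> 0)%R by (apply pow_nonzero; lra).
rewrite (fact_simpl j), mult_INR.
pose proof (INR_fact_neq_0 j); pose proof (INR_fact_neq_0 p).
destruct p as [|p]; unfold ballot.
- rewrite Nat.mul_0_r, Nat.add_0_r, (fact_simpl j), mult_INR; simpl (0 + j)%nat.
  change (INR (fact 0)) with 1%R; field; repeat split; assumption.
- replace (2 * p + 1 + S j)%nat with (2 * S p + j)%nat by lia.
  rewrite (Nat.add_comm (S j) (S p)).
  pose proof (INR_fact_neq_0 (S p + S j)).
  field; repeat split; assumption.
Qed.

(** Compare the coefficients of each [X j]: after the exchange with [k = j + p], the sum over [p] is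
    [ballot_convolution] at [m = n - j]. *)
Lemma ballot_double_sum (n : nat) (X : nat -> C) :
  INR (fact n) *
    sum_n (fun k => 2 ^ k / INR (fact k) * Binomial.C (2 * n - 2 * k) (n - k) *
       sum_n (fun j => INR (odd_dfact (k - j)) / INR (fact (n - j)) *
         binomZ (2 * Z.of_nat k - Z.of_nat j - 1) (Z.of_nat j - 1) * X j) k) n =
  sum_n (fun j => INR (binom n j) * INR (binom (2 * n - j) n) * 2 ^ j * X j) n.
Proof.
rewrite <- Csum_mult_l.
rewrite (Csum_ext _ (fun k => sum_n (fun j =>
  INR (fact n) * (2 ^ k / INR (fact k) * Binomial.C (2 * n - 2 * k) (n - k)) *
  (INR (odd_dfact (k - j)) / INR (fact (n - j)) *
   binomZ (2 * Z.of_nat k - Z.of_nat j - 1) (Z.of_nat j - 1) * X j)) k)).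
2: { intros k _; rewrite Csum_mult_l; Cring. }
rewrite (Csum_triangle (fun k j =>
  INR (fact n) * (2 ^ k / INR (fact k) * Binomial.C (2 * n - 2 * k) (n - k)) *
  (INR (odd_dfact (k - j)) / INR (fact (n - j)) *
   binomZ (2 * Z.of_nat k - Z.of_nat j - 1) (Z.of_nat j - 1) * X j))).
apply Csum_ext; intros j Hj.
replace (2 * n - j)%nat with (2 * (n - j) + j)%nat by lia.
replace (binom (2 * (n - j) + j) n) with (binom (2 * (n - j) + j) (n - j)).
2: { apply INR_eq; rewrite !INR_binom by lia.
     replace (2 * (n - j) + j - (n - j))%nat with n by lia.
     replace (2 * (n - j) + j - n)%nat with (n - j)%nat by lia.
     f_equal; ring. }
rewrite <- ballot_convolution.
transitivity (INR (binom n j) * 2 ^ j * X j *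
  sum_n (fun p => ballot j p *
    INR (binom (2 * (n - j - p)) (n - j - p))) (n - j)); [|Cring].
rewrite <- Csum_mult_l; apply Csum_ext; intros p Hp.
replace (j + p - j)%nat with p by lia.
replace (2 * n - 2 * (j + p))%nat with (2 * (n - j - p))%nat by lia.
replace (n - (j + p))%nat with (n - j - p)%nat by lia.
rewrite Binomial_C_binom by lia.
pose proof (f_equal RtoC (binomZ_ballot j p)) as E.
rewrite !RtoC_mult, RtoC_pow in E.
assert (Hjp := INR_fact_C_neq_0 (j + p)).
replace (RtoC (ballot j p)) with
  (INR (fact (j + p)) * ballot j p / INR (fact (j + p))) by (field; exact Hjp).
rewrite <- E, (INR_binom n j), RtoC_div, RtoC_mult, Cpow_add_r by
  (try lia; apply Rmult_integral_contrapositive; split; apply INR_fact_neq_0).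
Cfield; auto using INR_fact_C_neq_0.
Qed.

(** * Both formulas from the Legendre form *)

Theorem mainTheorem11 :
  forall (n : nat) (z : C),
  (1 <= n)%nat ->
  (Cmod z < 1)%R ->
  let s := Csqrt (z / (z - 1)) in
  is_hyp2F1 (1 - INR n / 2) (1 - INR n / 2) (3 / 2 - INR n) z
    (Cpower (1 - z) (INR n / 2 - 1) / (4 * Binomial.C (2 * n - 2) (n - 1)) *
     sum_n_m (fun k : nat =>
       2 ^ k * Binomial.C (2 * n - k - 1) (n - 1) * Binomial.C (n - 1) (k - 1) *
       ((1 - s) ^ (n - k) + (- (1)) ^ (k - 1) * (1 + s) ^ (n - k)) *
       s ^ (k - 1)) 1 n)
  /\
  is_hyp2F1 (1 / 2 - INR n / 2) (1 / 2 - INR n / 2) (1 / 2 - INR n) z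
    (INR (fact n) * Cpower (1 - z) ((INR n - 1) / 2) /
       (2 * Binomial.C (2 * n) n) *
     sum_n_m (fun k : nat =>
       2 ^ k / INR (fact k) * Binomial.C (2 * n - 2 * k) (n - k) *
       sum_n_m (fun j : nat =>
         INR (odd_dfact (k - j)) / INR (fact (n - j)) *
         binomZ (2 * Z.of_nat k - Z.of_nat j - 1) (Z.of_nat j - 1) *
         ((1 - s) ^ (n - j) + (- (1)) ^ j * (1 + s) ^ (n - j)) *
         s ^ j) 0 k) 0 n).
Proof.
intros n z Hn Hz s; split.
- destruct n as [|N]; [lia|].
  pose proof (hyp2F1_legendre N z Hz) as H; cbv zeta in H; fold s in H.
  pose proof (central_binom_neq_0 N) as HB.
  rewrite <- sum_n_m_S.
  replace (1 - INR (S N) / 2) with (1 / 2 - INR N / 2)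
    by (rewrite INR_C_S; field; apply RtoC_2_neq_0).
  replace (3 / 2 - INR (S N)) with (1 / 2 - INR N)
    by (rewrite INR_C_S; field; apply RtoC_2_neq_0).
  replace (INR (S N) / 2 - 1) with ((INR N - 1) / 2)
    by (rewrite INR_C_S; field; apply RtoC_2_neq_0).
  replace (2 * S N - 2)%nat with (2 * N)%nat by lia.
  replace (S N - 1)%nat with N by lia.
  rewrite Binomial_C_binom by lia.
  (* After the index shift, 2^(k+1) leaves a factor 2 beside the symmetric form, so the sum is 4
     times [legendre N s] and cancels the 4. *)
  match goal with |- is_hyp2F1 _ _ _ _ (_ * ?x) =>
    replace x with (2 * (2 * legendre N s)) end.
  + match goal with |- is_hyp2F1 _ _ _ _ ?x =>
      replace x with (Cpower (1 - z) ((INR N - 1) / 2) /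
        INR (binom (2 * N) N) * legendre N s); [exact H|] end.
    replace (RtoC 4) with (RtoC 2 * RtoC 2) by (rewrite <- RtoC_mult; f_equal; ring).
    field; auto using RtoC_2_neq_0.
  + rewrite legendre_symmetric, <- Csum_mult_l; apply Csum_ext; intros k Hk.
    replace (2 * S N - S k - 1)%nat with (2 * N - k)%nat by lia.
    replace (S k - 1)%nat with k by lia.
    rewrite !Binomial_C_binom, Cpow_S by lia; simpl Nat.sub; Cring.
- pose proof (hyp2F1_legendre n z Hz) as H; cbv zeta in H; fold s in H.
  pose proof (central_binom_neq_0 n) as HB.
  rewrite Binomial_C_binom by lia.
  match goal with |- is_hyp2F1 _ _ _ _ (_ * ?x) => set (T := x) end.
  (* Take [X j] to be the bracket times s^j in [ballot_double_sum]. *)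
  assert (ET : INR (fact n) * T = 2 * legendre n s).
  { rewrite legendre_symmetric.
    rewrite (Csum_ext _ (fun j => INR (binom n j) * INR (binom (2 * n - j) n) *
      2 ^ j * (((1 - s) ^ (n - j) + (- (1)) ^ j * (1 + s) ^ (n - j)) * s ^ j)))
      by (intros j _; Cring).
    rewrite <- ballot_double_sum; f_equal; apply Csum_ext; intros k _.
    f_equal; apply Csum_ext; intros j _; Cring. }
  match goal with |- is_hyp2F1 _ _ _ _ ?x =>
    replace x with (Cpower (1 - z) ((INR n - 1) / 2) /
      INR (binom (2 * n) n) * legendre n s); [exact H|] end.
  replace (legendre n s) with (INR (fact n) * T / 2)
    by (rewrite ET; field; apply RtoC_2_neq_0).
  field; auto using RtoC_2_neq_0.
Qed.
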